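(* Let $G$ be a connected graph with at least two vertices and let $H$ be a graph (not necessarily connected). Then the following hold for the corona product $G\circ H$. (i) $G\circ H$ is $(\mathrm{diam}(G)+2)$-distance-balanced if and only if $G$ is $\mathrm{diam}(G)$-distance-balanced. (ii) If $\ell\in\{3,\ldots,\mathrm{diam}(G)+1\}$, then $G\circ H$ is not $\ell$-distance-balanced.
   Context: All graphs are finite, simple and undirected, with nonempty vertex set. $d_X$ denotes the geodesic distance in a connected graph $X$ and $\mathrm{diam}(X)$ the maximum distance between pairs of vertices of $X$. For vertices $u,v$ of $X$, $W_{uv}=\{w\in V(X): d_X(w,u)<d_X(w,v)\}$. For a positive integer $\ell$, a connected graph $X$ with $\mathrm{diam}(X)\geq\ell$ is $\ell$-distance-balanced if $|W_{uv}|=|W_{vu}|$ for all $u,v\in V(X)$ with $d_X(u,v)=\ell$. The corona product $G\circ H$ is obtained by taking one copy of $G$ and $|V(G)|$ copies of $H$ and joining each vertex of the $i$-th copy of $H$ with the $i$-th vertex of $G$. *)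

(* Defs.v *)
From mathcomp Require Import all_boot.
Set Implicit Arguments.
Unset Strict Implicit.
Unset Printing Implicit Defensive.

Record sgraph := SGraph {
  vertex :> finType;
  adj : rel vertex;
  adj_sym : symmetric adj;
  adj_irrefl : irreflexive adj;
  vertex_gt0 : 0 < #|vertex| }.

Definition connected (X : sgraph) : Prop :=
  forall u v : X, connect (@adj X) u v.

(* Length of a shortest walk from u to v. Such a walk has fewer than #|X|
   edges, so the search range suffices; if v is not reachable from u, the
   value is the junk value #|X|. *)
Definition dist (X : sgraph) (u v : X) : nat :=
  find (fun n => [exists p : n.-tuple X, path (@adj X) u p && (last u p == v)])
       (iota 0 #|X|).

(* Meaningful only for connected X, because of the junk values of dist. *)
Definition diam (X : sgraph) : nat := \max_(u : X) \max_(v : X) dist u v.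

Definition Wset (X : sgraph) (u v : X) : {set X} :=
  [set w | dist w u < dist w v].

Definition distance_balanced (l : nat) (X : sgraph) : Prop :=
  [/\ 0 < l, connected X, l <= diam X &
      forall u v : X, dist u v = l -> #|Wset u v| = #|Wset v u|].

Section Corona.
Variables G H : sgraph.

(* inl x is the vertex x of G; inr (x, h) is the vertex h in the copy of H
   attached to x. *)
Definition corona_adj : rel (G + G * H)%type := fun a b =>
  match a, b with
  | inl x, inl y => adj x y
  | inl x, inr (y, _) => x == y
  | inr (x, _), inl y => x == y
  | inr (x, h), inr (y, k) => (x == y) && adj h k
  end.

Lemma corona_adj_sym : symmetric corona_adj.
Proof.
move=> [x|[x h]] [y|[y k]] //=; first exact: adj_sym.
by rewrite eq_sym adj_sym.
Qed.

Lemma corona_adj_irrefl : irreflexive corona_adj.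
Proof. by move=> [x|[x h]] /=; rewrite adj_irrefl ?andbF. Qed.

Lemma corona_vertex_gt0 : 0 < #|{: (G + G * H)%type}|.
Proof. by rewrite card_sum addn_gt0 vertex_gt0. Qed.

Definition corona : sgraph :=
  SGraph corona_adj_sym corona_adj_irrefl corona_vertex_gt0.

End Corona.

(* Main.v *)
Require Import Defs.
From mathcomp Require Import all_boot zify.

(** A walk in the corona that leaves the pendant copy of H at x must pass
    through x itself.  Hence two vertices lying over distinct base vertices
    x, y of G are at distance d(x, y) plus one for each of them that sits in a
    copy of H, while vertices over the same base are at distance at most 2
    ([dist_corona]).  A distance of at least 3 is therefore governed by G, and
    the sets W of such a pair are unions of whole fibres of the projection to
    G, each fibre having 1 + |H| elements.

    Distance diam G + 2 occurs exactly between copies of H over a diametral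
    pair x, y, and then W in the corona is the preimage of W_xy
    ([Wset_corona_copies]); cancelling 1 + |H| gives part (i).

    For part (ii), choose x, y in G at distance l - 1 >= 2.  The vertex x and a
    vertex pendant at y are at distance l, and balance for them reads
      #{z | d(z,x) <= d(z,y)} = #{z | d(z,y) + 1 < d(z,x)}.
    The same holds with x and y exchanged.  Each left-hand set contains
    the right-hand set of the other equation, so all four cardinals agree and
    no z satisfies |d(z,x) - d(z,y)| <= 1.  But along a walk from x to y the
    difference d(z,x) - d(z,y) changes by at most 2 per step and goes from
    at most -2 to at least 2, so it must meet {-1, 0, 1}
    ([near_bisector]). *)

Set Implicit Arguments.
Unset Strict Implicit.
Unset Printing Implicit Defensive.

(** * Distance in a connected graph *)

Section Distance.
Variable X : sgraph.
Implicit Types (u v w : X) (p : seq X) (f : X -> nat).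

Lemma dist_le_size u p : path (@adj X) u p -> dist u (last u p) <= size p.
Proof.
move=> up; have [lt_pX | le_Xp] := ltnP (size p) #|X|; last first.
  apply: leq_trans le_Xp; rewrite -[X in _ <= X](size_iota 0).
  exact: find_size.
rewrite leqNgt; apply/negP => /(before_find 0).
rewrite nth_iota // add0n => /existsP; apply.
by exists (in_tuple p); rewrite up eqxx.
Qed.

Lemma dist_path u v : connect (@adj X) u v ->
  exists p, [/\ path (@adj X) u p, last u p = v & size p = dist u v].
Proof.
case/connectP => p0 up0 ->; case/shortenP: up0 => p up Up _.
set has_walk := fun n => [exists q : n.-tuple X,
  path (@adj X) u q && (last u q == last u p)].
(* A walk without repeated vertices is short enough for the bounded search. *)
have walk: has has_walk (iota 0 #|X|).
  apply/hasP; exists (size p); last first.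
    by apply/existsP; exists (in_tuple p); rewrite up eqxx.
  by rewrite mem_iota -[_.+1]/(size (u :: p)) -(card_uniqP Up) max_card.
have := nth_find 0 walk; rewrite -[find _ _]/(dist u (last u p)).
have lt_dX: dist u (last u p) < #|X| by rewrite -[X in _ < X](size_iota 0) -has_find.
rewrite nth_iota // add0n => /existsP[q /andP[uq /eqP lq]].
by exists q; rewrite size_tuple.
Qed.

Lemma distxx u : dist u u = 0.
Proof. by apply/eqP; rewrite -leqn0 (@dist_le_size u [::]). Qed.

Lemma lipschitz_le_dist f u v : connect (@adj X) u v ->
    (forall w w', adj w w' -> f w <= (f w').+1) -> f v = 0 ->
  f u <= dist u v.
Proof.
move=> /dist_path[p [up <- <-]] lip.
elim: p u up => [|w p IHp] u /= => [_ -> // | /andP[uw wp] fv0].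
by apply: leq_trans (lip _ _ uw) _; rewrite ltnS IHp.
Qed.

(** Each step to a neighbour lowers [f] by at least one, so at most [f u] steps
    are made before [f] vanishes, which only happens at [v]. *)
Lemma descent_walk f v :
    (forall w, 0 < f w -> exists2 w', adj w w' & f w' < f w) ->
    (forall w, f w = 0 -> w = v) ->
  forall u, exists p, [/\ path (@adj X) u p, last u p = v & size p <= f u].
Proof.
move=> desc zero u; have [n le_fn] := ubnP (f u).
elim: n u le_fn => // n IHn u; rewrite ltnS => le_fn.
have [fu0 | fu_gt0] := posnP (f u); first by exists [::]; rewrite (zero u).
have [w uw lt_wu] := desc u fu_gt0.
have [p [wp lp szp]] := IHn w (leq_trans lt_wu le_fn).
by exists (w :: p); rewrite /= uw wp (leq_trans _ lt_wu).
Qed.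

(** A certificate for a closed formula of the distance to [v]: the Lipschitz
    condition bounds [f] by the length of every walk, and descent produces a
    walk of length at most [f u].  Connectivity comes out of descent as well. *)
Lemma dist_unique f v :
    (forall w w', adj w w' -> f w <= (f w').+1) ->
    (forall w, 0 < f w -> exists2 w', adj w w' & f w' < f w) ->
    (forall w, (f w == 0) = (w == v)) ->
  forall u, connect (@adj X) u v /\ dist u v = f u.
Proof.
move=> lip desc zero u.
have zero' w: f w = 0 -> w = v by move/eqP; rewrite zero => /eqP.
have [p [up lp szp]] := descent_walk desc zero' u.
have uv: connect (@adj X) u v by apply/connectP; exists p.
split=> //; apply/eqP; rewrite eqn_leq (lipschitz_le_dist uv lip) ?andbT.
  by rewrite -lp (leq_trans (dist_le_size up)).
by apply/eqP; rewrite zero.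
Qed.

Lemma dist_le_diam u v : dist u v <= diam X.
Proof.
apply: leq_trans (leq_bigmax (F := fun u => \max_v dist u v) u).
exact: (leq_bigmax (F := dist u)).
Qed.

Lemma diam_attained : exists u v, dist u v = diam X.
Proof.
have [u du] := eq_bigmax (fun u : X => \max_(v : X) dist u v) (vertex_gt0 X).
have [v dv] := eq_bigmax (dist u) (vertex_gt0 X).
by exists u, v; rewrite /diam du dv.
Qed.

Hypothesis connX : connected X.

Lemma dist_eq0 u v : (dist u v == 0) = (u == v).
Proof.
apply/eqP/eqP => [d0 | ->]; last exact: distxx.
have [p [_ lp szp]] := dist_path (connX u v).
by rewrite -lp (size0nil (etrans szp d0)).
Qed.

Lemma dist_adj_step u w v : adj u w -> dist u v <= (dist w v).+1.
Proof.
have [p [wp <- <-]] := dist_path (connX w v) => uw.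
by rewrite (@dist_le_size u (w :: p)) //= uw.
Qed.

Lemma dist_descent u v :
  0 < dist u v -> exists2 w, adj u w & dist w v < dist u v.
Proof.
have [[|w p] [up <- <-]] // := dist_path (connX u v).
by case/andP: up => uw wp _; exists w; rewrite // ltnS dist_le_size.
Qed.

Lemma dist_sym u v : dist u v = dist v u.
Proof.
suff le_sym u' v' : dist u' v' <= dist v' u'.
  by apply/eqP; rewrite eqn_leq !le_sym.
apply: (lipschitz_le_dist (f := dist u')) (distxx u') => // w w' ww'.
have [p [up lp <-]] := dist_path (connX u' w').
have := @dist_le_size u' (rcons p w).
by rewrite last_rcons size_rcons rcons_path up lp adj_sym; apply.
Qed.

(** Used as a discrete intermediate value principle: for a function that varies
    little along edges, an edge crossing a threshold pins down its value. *)
Lemma edge_across (P : pred X) u v : P u -> ~~ P v ->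
  exists w w', [/\ adj w w', P w & ~~ P w'].
Proof.
case/connectP: (connX u v) => p up -> {v}.
elim: p u up => [|w p IHp] u /= => [_ -> // | /andP[uw wp] Pu nPv].
by have [Pw | nPw] := boolP (P w); [apply: IHp nPv | exists u, w].
Qed.

(** On an edge that leaves the set of vertices farther than [m] from a vertex
    [v], the outer end is at distance exactly [m]. *)
Lemma dist_takes_all_values m : m <= diam X -> exists u v : X, dist u v = m.
Proof.
have [u [v <-]] := diam_attained => le_m.
have [d_m | d_neq] := eqVneq (dist u v) m; first by exists u, v.
have [||w [w' [ww' /= lt_mw le_w'm]]] :=
  @edge_across (fun w => m < dist w v) u v; first by lia.
  by rewrite distxx.
by exists w', v; have := dist_adj_step v ww'; lia.
Qed.

(** Each of the two distances changes by at most one along an edge, so on an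
    edge where their difference stops being negative it cannot jump from below
    -1 to above 1: one of the two ends will do. *)
Lemma near_bisector (x y : X) : exists z : X,
  dist z x <= (dist z y).+1 /\ dist z y <= (dist z x).+1.
Proof.
have [<- | xNy] := eqVneq x y; first by exists x.
have [||w [w' [ww' /= lt_w le_w']]] :=
    @edge_across (fun z => dist z x < dist z y) x y.
- by rewrite distxx lt0n dist_eq0.
- by rewrite distxx.
have w'w: adj w' w by rewrite adj_sym.
have := dist_adj_step x ww'; have := dist_adj_step y ww'.
have := dist_adj_step x w'w; have := dist_adj_step y w'w.
have [near_w | far_w] := leqP (dist w y) (dist w x).+1; last first.
  by exists w'; lia.
by exists w; lia.
Qed.

End Distance.

(** * Distance in the corona *)

Section CoronaDistance.
Variables (G H : sgraph) (connG : connected G).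

Definition base (a : corona G H) : G :=
  match a with inl x => x | inr (x, _) => x end.

(** Two vertices in the same copy of H are never farther than 2 apart, through
    their common neighbour in G, whatever their distance in H. *)
Definition corona_dist (a b : corona G H) : nat :=
  match a, b with
  | inl x, inl y => dist x y
  | inl x, inr (y, _) => (dist x y).+1
  | inr (x, _), inl y => (dist x y).+1
  | inr (x, h), inr (y, k) =>
      if x == y then if h == k then 0 else if adj h k then 1 else 2
      else (dist x y).+2
  end.

Lemma corona_dist_eq0 a b : (corona_dist a b == 0) = (a == b).
Proof.
case: a b => [x|[x h]] [y|[y k]] //=; first exact: dist_eq0.
have ->: (inr (x, h) == inr (y, k) :> corona G H) = (x == y) && (h == k) by [].
by case: (x == y) => //; case: (h == k); last case: (adj h k).
Qed.

Lemma corona_dist_lipschitz b a a' :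
  adj a a' -> corona_dist a b <= (corona_dist a' b).+1.
Proof.
have adjG x x' y : @adj G x x' -> dist x y <= (dist x' y).+1.
  exact: dist_adj_step.
case: a a' b => [x|[x h]] [x'|[x' h']] [y|[y k]] /=.
- exact: adjG.
- by move/adjG => /(_ y); rewrite ltnS.
- by move/eqP->; lia.
- by move/eqP <-; case: eqVneq => [->|_]; rewrite ?distxx //; lia.
- by move/eqP->; lia.
- by move/eqP->; case: eqVneq => [->|_]; rewrite ?distxx //; do 2?case: ifP.
- by case/andP=> /eqP-> _; lia.
- case/andP=> /eqP-> hh'; case: (x' == y) => //.
  case: (eqVneq h' k) => [<-|_]; first by rewrite hh'; case: ifP.
  by do 3?case: ifP.
Qed.

Lemma corona_dist_descent b a : 0 < corona_dist a b ->
  exists2 a' : corona G H, adj a a' & corona_dist a' b < corona_dist a b.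
Proof.
case: a b => [x|[x h]] [y|[y k]] /=.
- by case/(dist_descent connG) => w xw lt_w; exists (inl w).
- move=> _; have [->|xNy] := eqVneq x y.
    by exists (inr (y, k)) => /=; rewrite !eqxx.
  have /(dist_descent connG)[w xw lt_w]: 0 < dist x y by rewrite lt0n dist_eq0.
  by exists (inl w).
- by move=> _; exists (inl x) => /=.
- case: eqVneq => [<- | xNy] d_gt0; last by exists (inl x) => /=.
  have [hk | nhk] := boolP (adj h k).
    exists (inr (x, k)); first by rewrite /= eqxx.
    by move: d_gt0; rewrite /= !eqxx; case: ifP.
  exists (inl x); first by rewrite /= eqxx.
  by move: d_gt0; rewrite /= distxx; case: ifP.
Qed.

Lemma dist_corona_connect (a b : corona G H) :
  connect (@adj (corona G H)) a b /\ dist a b = corona_dist a b.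
Proof.
apply: (dist_unique (f := corona_dist^~ b)) => [w w'|w|w].
- exact: corona_dist_lipschitz.
- exact: corona_dist_descent.
- exact: corona_dist_eq0.
Qed.

Lemma corona_connected : connected (corona G H).
Proof. by move=> a b; have [] := dist_corona_connect a b. Qed.

Lemma dist_corona (a b : corona G H) : dist a b = corona_dist a b.
Proof. by have [] := dist_corona_connect a b. Qed.

Lemma card_preim_base (A : {set G}) : #|base @^-1: A| = (#|H|).+1 * #|A|.
Proof.
rewrite -sum1_card big_sumType /=.
rewrite (eq_bigl [in A]) => [|x]; last by rewrite inE.
rewrite (eq_bigl (fun c : G * H => (c.1 \in A) && true)) => [|[x h]]; last first.
  by rewrite inE andbT.
rewrite -(pair_big [in A] xpredT (fun _ _ => 1)) /=.
by rewrite !sum1_card sum_nat_const mulSn mulnC.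
Qed.

(** * The sets W in the corona *)

(** Over a third base vertex the pendant edges lengthen both distances equally.
    The fibres over [x] and [y] need a look of their own: all of the
    fibre over [x] is within 2 of [(x, h)] and farther from [(y, k)]. *)
Lemma Wset_corona_copies (x y : G) (h k : H) : x != y ->
  Wset (inr (x, h) : corona G H) (inr (y, k)) = base @^-1: Wset x y.
Proof.
move=> xNy; have := xNy; rewrite -(dist_eq0 connG) => dxy.
have dyx: dist y x != 0 by rewrite dist_sym.
apply/setP => -[z|[z j]]; rewrite !inE !dist_corona /= ?ltnS //.
have [-> | zNx] := eqVneq z x.
  by rewrite (negPf xNy) distxx; do 2?case: ifP; lia.
have [-> | zNy] := eqVneq z y; last by [].
by rewrite distxx; do 2?case: ifP; lia.
Qed.

(** The edge pendant at [y] turns the strict comparison of distances in G into a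
    weak one, and, with the roles exchanged, into one with a gap of two.  The
    hypothesis [1 < dist x y] puts the fibre over [y] on the side of [y]:
    its points are within 2 of [(y, k)], and the one in G within 1. *)
Lemma Wset_corona_base_copy (x y : G) (k : H) : 1 < dist x y ->
  Wset (inl x : corona G H) (inr (y, k))
    = base @^-1: [set z | dist z x <= dist z y].
Proof.
move=> dxy; have dyx: 1 < dist y x by rewrite dist_sym.
apply/setP => -[z|[z j]]; rewrite !inE !dist_corona /= ?ltnS //.
have [-> | zNy] := eqVneq z y; last by [].
by rewrite distxx; do 2?case: ifP; lia.
Qed.

Lemma Wset_corona_copy_base (x y : G) (k : H) : 1 < dist x y ->
  Wset (inr (y, k) : corona G H) (inl x)
    = base @^-1: [set z | (dist z y).+1 < dist z x].
Proof.
move=> dxy; have dyx: 1 < dist y x by rewrite dist_sym.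
apply/setP => -[z|[z j]]; rewrite !inE !dist_corona /= ?ltnS //.
have [-> | zNy] := eqVneq z y; last by [].
by rewrite distxx; do 2?case: ifP; lia.
Qed.

End CoronaDistance.

(** * Balance in the corona *)

Theorem theorem4p4 (G H : sgraph) (hG : connected G) (hG2 : 2 <= #|G|) :
  (distance_balanced (diam G + 2) (corona G H) <-> distance_balanced (diam G) G)
  /\
  (forall l : nat, 3 <= l <= diam G + 1 -> ~ distance_balanced l (corona G H)).
Proof.
have /card_gt0P[h _] := vertex_gt0 H.
have diam_gt0: 0 < diam G.
  have /card_gt1P[x [y [_ _ xNy]]] := hG2.
  by apply: leq_trans (dist_le_diam x y); rewrite lt0n dist_eq0.
split; first split.
- case=> _ _ _ balGH; split=> // x y dxy.
  have xNy: x != y by rewrite -dist_eq0 // dxy -lt0n.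
  have /balGH: dist (inr (x, h) : corona G H) (inr (y, h)) = diam G + 2.
    by rewrite dist_corona //= (negPf xNy) dxy addn2.
  rewrite !Wset_corona_copies // 1?eq_sym // !card_preim_base.
  by move/eqP; rewrite eqn_pmul2l // => /eqP.
- case=> _ _ _ balG; split=> [||| a b]; first by rewrite addn2.
  + exact: corona_connected.
  + have [x [y dxy]] := diam_attained G.
    have xNy: x != y by rewrite -dist_eq0 // dxy -lt0n.
    rewrite -[diam G]dxy.
    have <-: dist (inr (x, h) : corona G H) (inr (y, h)) = dist x y + 2.
      by rewrite dist_corona //= (negPf xNy) addn2.
    exact: dist_le_diam.
  + (* Only two pendant vertices over a diametral pair are this far apart. *)
    rewrite dist_corona //; case: a b => [x|[x j]] [y|[y k]] /=;
      have := dist_le_diam x y; try lia.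
    case: eqVneq => [_ _ | xNy _]; first by do 2?case: ifP; lia.
    rewrite addn2 => -[dxy]; rewrite !Wset_corona_copies // 1?eq_sym //.
    by rewrite !card_preim_base balG.
- move=> l /andP[l_ge3 l_le] [_ _ _ balGH].
  have [|x [y dxy]] := @dist_takes_all_values G hG l.-1; first by lia.
  pose near (x y : G) := [set z | dist z x <= dist z y].
  pose far (x y : G) := [set z | (dist z y).+1 < dist z x].
  have card_near_far u v: dist u v = l.-1 -> #|near u v| = #|far u v|.
    move=> duv; have duv_gt1: 1 < dist u v by lia.
    have /balGH: dist (inl u : corona G H) (inr (v, h)) = l.
      by rewrite dist_corona //= duv; lia.
    rewrite Wset_corona_base_copy // Wset_corona_copy_base // !card_preim_base.
    by move/eqP; rewrite eqn_pmul2l // => /eqP.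
  (* Both inclusions far <= near become equalities, since their cardinals are
     linked in a cycle by eq_xy and eq_yx. *)
  have far_near u v: far u v \subset near v u.
    by apply/subsetP => z; rewrite !inE; lia.
  have eq_xy := card_near_far x y dxy.
  have eq_yx: #|near y x| = #|far y x| by apply: card_near_far; rewrite dist_sym.
  have far_eq_near u v: #|near v u| <= #|far u v| -> far u v = near v u.
    by move=> le_card; apply/eqP; rewrite eqEcard far_near.
  have le_xy := subset_leq_card (far_near x y).
  have le_yx := subset_leq_card (far_near y x).
  have /setP far_xy: far x y = near y x by apply: far_eq_near; lia.
  have /setP far_yx: far y x = near x y by apply: far_eq_near; lia.
  have [z [zx zy]] := near_bisector hG x y.
  by have := far_xy z; have := far_yx z; rewrite !inE; lia.
Qed.
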